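(* Each Clifford subsemigroup of $\mathbb{N}^{\mathbb{N}}$ (with the subspace topology) is ditopological.
   Context: $\mathbb{N}^{\mathbb{N}}$ is the monoid of all functions $\mathbb{N}\to\mathbb{N}$ under composition (functions act on the right and compose from left to right), with the product topology arising from the discrete topology on $\mathbb{N}$. An inverse semigroup is a semigroup $S$ such that for each $x\in S$ there is a unique $x^{-1}\in S$ with $xx^{-1}x=x$ and $x^{-1}xx^{-1}=x^{-1}$. It is Clifford if $xx^{-1}=x^{-1}x$ for all $x\in S$. A Clifford subsemigroup of $\mathbb{N}^{\mathbb{N}}$ is a subsemigroup which is itself a Clifford semigroup. $E(S)=\{e\in S: e^2=e\}$. A semigroup topology is a topology for which multiplication is continuous. An inverse semigroup $S$ with a semigroup topology is called ditopological if inversion is continuous and for any point $x\in S$ and any neighbourhood $O$ of $x$ there are neighbourhoods $U$ and $W$ of $x$ and $xx^{-1}$, respectively, such that $$\{s\in S : \exists b\in U,\ \exists e\in W\cap E(S)\text{ such that } b=es\}\cap\{s\in S : ss^{-1}\in W\}\subseteq O.$$ *)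

(* Defs.v *)
From HB Require Import structures.
From mathcomp Require Import all_boot all_classical.
From mathcomp Require Import topology function_spaces.
Set Implicit Arguments.
Unset Strict Implicit.
Unset Printing Implicit Defensive.
Local Open Scope classical_set_scope.
Local Open Scope group_scope.

(* A semigroup carrying a topology, with no compatibility required: continuity
   of the multiplication is the separate predicate [semigroup_topology]. *)
#[short(type="semigroupTopologicalType")]
HB.structure Definition SemigroupTopological :=
  {G of Topological G & Semigroup G}.

Definition semigroup_topology (G : semigroupTopologicalType) : Prop :=
  continuous (fun p : G * G => p.1 * p.2).

Definition idempotents (G : semigroupType) : set G :=
  [set e | e * e = e].

Definition is_inverse (G : semigroupType) (x y : G) : Prop :=
  x * y * x = x /\ y * x * y = y.

Definition inverse_semigroup (G : semigroupType) : Prop :=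
  forall x : G, exists! y : G, is_inverse x y.

(* The inverse of [x] when [G] is an inverse semigroup; the default value [x]
   is returned only if [x] has no inverse at all. *)
Definition sinv (G : semigroupType) (x : G) : G := xget x (is_inverse x).

Definition clifford_semigroup (G : semigroupType) : Prop :=
  inverse_semigroup G /\ forall x : G, x * sinv x = sinv x * x.

Definition ditopological (G : semigroupTopologicalType) : Prop :=
  [/\ inverse_semigroup G,
      semigroup_topology G,
      continuous (@sinv G) &
      forall (x : G) (O : set G), nbhs x O ->
        exists U W : set G,
          [/\ nbhs x U, nbhs (x * sinv x) W &
              [set s : G | exists b e : G,
                 [/\ U b, (W `&` @idempotents G) e & b = e * s]] `&`
              [set s : G | W (s * sinv s)] `<=` O]].

Definition is_subsemigroup (G : semigroupType) (S : set G) : Prop :=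
  forall x y, S x -> S y -> S (x * y).

(* A subsemigroup as a semigroup in its own right, on the sigma type
   [set_type S], which carries the subspace topology. *)
Definition subsemigroup (G : semigroupTopologicalType) (S : set G)
  (hS : is_subsemigroup S) : Type := set_type S.

Lemma subsemigroup_mulg_closed (G : semigroupType) (S : set G)
  (hS : is_subsemigroup S) : mulg_closed [pred x | x \in S].
Proof.
by move=> x y /set_mem Sx /set_mem Sy; apply: mem_set; exact: hS.
Qed.

HB.instance Definition _ (G : semigroupTopologicalType) (S : set G)
  (hS : is_subsemigroup S) :=
  Topological.copy (subsemigroup hS) (set_type S).
HB.instance Definition _ (G : semigroupTopologicalType) (S : set G)
  (hS : is_subsemigroup S) :=
  SubChoice.copy (subsemigroup hS) (set_type S).
HB.instance Definition _ (G : semigroupTopologicalType) (S : set G)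
  (hS : is_subsemigroup S) :=
  SubChoice_isSubSemigroup.Build G _ (subsemigroup hS)
    (subsemigroup_mulg_closed hS).

(* The full transformation monoid of nat with the product topology. The alias
   keeps composition from being attached to every type [nat -> nat]. *)
Definition NN : Type := {ptws nat -> nat}.

HB.instance Definition _ := Topological.copy NN {ptws nat -> nat}.

(* Functions act on the right: [x * y] is [x] followed by [y]. *)
Definition NN_mul (x y : NN) : NN := fun n => y (x n).
Definition NN_one : NN := fun n => n.

Lemma NN_mulA : associative NN_mul. Proof. by []. Qed.
Lemma NN_mul1g : left_id NN_one NN_mul. Proof. by []. Qed.
Lemma NN_mulg1 : right_id NN_one NN_mul. Proof. by []. Qed.

HB.instance Definition _ := isMonoid.Build NN NN_mulA NN_mul1g NN_mulg1.

(* Main.v *)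
Require Import Defs.
From mathcomp Require Import all_boot all_classical.
From mathcomp Require Import topology function_spaces.

Set Implicit Arguments.
Unset Strict Implicit.
Unset Printing Implicit Defensive.
Local Open Scope classical_set_scope.

(** A basic neighbourhood of a transformation [x] consists of the
    transformations agreeing with [x] on some finite list of points
    ([NN_nbhsP], [subsemigroup_nbhsP]), so each of the required continuity
    properties says that a value at one point is controlled by finitely many
    values elsewhere.

    In a Clifford semigroup of transformations, put [e = x * sinv x].  Since
    [x] and [sinv x] commute, [e], [x] and [sinv x] share the same image and
    the same kernel, [e] is a retraction onto that image, and [x] and [sinv x]
    restrict to mutually inverse permutations of it.

    - Inversion ([act_sinv_eq]).  If [m] is the image of [n] under [sinv x],
      then [x] sends [m] to the image [k] of [n] under [e], sends [n] and [k]
      to the same point, and hits [m].  If [z] does the same, then [m] lies in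
      the image of [z] and [n], [k] lie in one kernel class of [z]; hence
      [sinv z] must send [n] to [m] as well.

    - The neighbourhood condition ([act_eq_of_factor]).  Let [p] be the image
      of [n] under [e].  If [s * sinv s] agrees with [e] at [n], then [s]
      cannot distinguish [n] from [p].  If moreover [b = e' * s], where [e']
      agrees with [e] at [p] and so fixes [p], then [s] and [b] agree at [p].
      So if [b] agrees with [x] at [p], then [s] agrees with [x] at [n]. *)

Lemma is_inverse_sinv (G : semigroupType) (x : G) :
  inverse_semigroup G -> is_inverse x (sinv x).
Proof. by move=> /(_ x)[y [xy _]]; apply: (xgetPex x); exists y. Qed.

Definition agree_on (s : seq nat) (f g : nat -> nat) := {in s, f =1 g}.

Lemma agree_catP s t f g :
  agree_on (s ++ t) f g <-> agree_on s f g /\ agree_on t f g.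
Proof.
split=> [h|[hs ht] n]; last by rewrite mem_cat => /orP[/hs|/ht].
by split=> n nin; apply: h; rewrite mem_cat nin ?orbT.
Qed.

(** Convergence for the product topology is pointwise, so it suffices to see
    that the filter generated by the cylinders around [x] converges to [x] at
    each point, where the topology is discrete. *)
Lemma NN_nbhsP (x : NN) (O : set NN) :
  nbhs x O <-> exists s, [set z : NN | agree_on s z x] `<=` O.
Proof.
split.
  pose F : set_system NN :=
    [set A | exists s, [set z : NN | agree_on s z x] `<=` A].
  have FF : Filter F.
    split.
    - by exists nil.
    - move=> A B [s sA] [t tB]; exists (s ++ t) => z /agree_catP[zs zt].
      by split; [exact: sA | exact: tB].
    - by move=> A B AB [s sA]; exists s => z /sA /AB.
  suff : {ptws, F --> x} by apply.
  apply/(pointwise_cvgP x FF) => n A /nbhs_singleton An.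
  by exists [:: n] => z /(_ n (mem_head _ _)) /= zn; rewrite /= zn.
move=> [s sO]; apply: (filterS sO); elim: s {sO} => [|n s IH].
  by apply: filterE => z m.
have xn : nbhs x [set z : NN | z n = x n].
  have /(pointwise_cvgP x (nbhs_filter x))/(_ n) : {ptws, nbhs x --> x} by [].
  by move/(_ [set x n] (discrete_set1 (x n))).
apply: filterS2 xn IH => z zn zs m.
by rewrite inE => /predU1P[->|/zs].
Qed.

Section TransformationSemigroup.
Variables (S : set NN) (hS : is_subsemigroup S).
Implicit Types x y z : subsemigroup hS.

Definition act x (n : nat) : nat := (\val x : NN) n.

Lemma actM x y n : act (x * y)%g n = act y (act x n).
Proof. by []. Qed.

Lemma subsemigroup_nbhsP x (O : set (subsemigroup hS)) :
  nbhs x O <-> exists s, [set z | agree_on s (act z) (act x)] `<=` O.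
Proof.
split.
  rewrite nbhsE => -[_ [[B oB <-] Bx] BO].
  have /NN_nbhsP[s sB] : nbhs (\val x : NN) B by apply: open_nbhs_nbhs.
  by exists s => z zs; apply: BO; apply: sB.
move=> [s sO]; apply: (filterS sO).
have xs : nbhs (\val x : NN) [set z : NN | agree_on s z (act x)].
  by apply/NN_nbhsP; exists s.
exact: (@initial_continuous _ _ (set_val : set_type S -> NN) x _ xs).
Qed.

(** To control [x * y] on [s], control [x] on [s] and [y] on the image of [s]
    under [x]. *)
Lemma semigroup_topology_subsemigroup : semigroup_topology (subsemigroup hS).
Proof.
move=> [x y] O /subsemigroup_nbhsP[s sO].
exists ([set z | agree_on s (act z) (act x)],
        [set z | agree_on (map (act x) s) (act z) (act y)]).
  by split; apply/subsemigroup_nbhsP; [exists s | exists (map (act x) s)].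
move=> [x' y'] [/= xs ys]; apply: sO => n ns.
by rewrite !actM xs // ys // map_f.
Qed.

Hypothesis cS : clifford_semigroup (subsemigroup hS).

Lemma act_mulVK x n : act x (act (sinv x) (act x n)) = act x n.
Proof. by rewrite -!actM mulgA (is_inverse_sinv x cS.1).1. Qed.

Lemma act_invMK x n : act (sinv x) (act x (act (sinv x) n)) = act (sinv x) n.
Proof. by rewrite -!actM mulgA (is_inverse_sinv x cS.1).2. Qed.

Lemma act_invC x n : act (sinv x) (act x n) = act x (act (sinv x) n).
Proof. by rewrite -!actM cS.2. Qed.

(** With [w = sinv z], the hypotheses say that [z n = z (i (x n))], that [z]
    maps [i n] to [i (x n)], and that [i n] is in the image of [z].  As [w]
    depends only on the [z]-class of its argument and inverts [z] on the image
    of [z], this gives [w n = w (i (x n)) = w (z (i n)) = i n]. *)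
Lemma act_sinv_eq x z n (i := act (sinv x)) :
  agree_on [:: n; i (act x n); i n; i (i n)] (act z) (act x) ->
  act (sinv z) n = i n.
Proof.
move=> zx.
have zn : act z n = act x n by rewrite zx ?inE ?eqxx.
have ze : act z (i (act x n)) = act x n.
  by rewrite zx ?inE ?eqxx ?orbT //; exact: act_mulVK.
have zi : act z (i n) = i (act x n).
  by rewrite zx ?inE ?eqxx ?orbT //; exact/esym/act_invC.
have zii : act z (i (i n)) = i n.
  by rewrite zx ?inE ?eqxx ?orbT // -act_invC; exact: act_invMK.
(* The value of [sinv z] at [n] is first expressed through [act z n], so that
   [n] can be traded for [i (act x n)], which [z] does not distinguish from it. *)
rewrite -act_invMK -act_invC zn -ze (act_invC z) act_invMK -zi.
by rewrite act_invC -zii act_mulVK.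
Qed.

Lemma continuous_sinv : continuous (@sinv (subsemigroup hS)).
Proof.
move=> x O /subsemigroup_nbhsP[s sO]; pose i := act (sinv x).
apply/subsemigroup_nbhsP.
exists (flatten [seq [:: n; i (act x n); i n; i (i n)] | n <- s]) => z zx.
apply: sO => n ns; apply: act_sinv_eq => m mn; apply: zx.
by apply/flatten_mapP; exists n.
Qed.

(** The pointwise core of the ditopological condition: [p] is the image of [n]
    under [x * sinv x], hence a point fixed by [e]; the factorisation of [b]
    then transfers the value of [b] at [p] to [s], and [s * sinv s] carries it
    back from [p] to [n]. *)
Lemma act_eq_of_factor x s b e n (p := act (sinv x) (act x n)) :
  act b p = act x p -> act e p = act (x * sinv x)%g p ->
  act (s * sinv s)%g n = act (x * sinv x)%g n -> b = (e * s)%g ->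
  act s n = act x n.
Proof.
rewrite !actM => bp ep sn bes.
have {}ep : act e p = p by rewrite ep act_invMK.
by rewrite -(act_mulVK s) sn -/p -ep -actM -bes bp act_mulVK.
Qed.

End TransformationSemigroup.

Theorem theorem2p8 (S : set NN) (hS : is_subsemigroup S) :
  clifford_semigroup (subsemigroup hS) -> ditopological (subsemigroup hS).
Proof.
move=> cS; split.
- exact: cS.1.
- exact: semigroup_topology_subsemigroup.
- exact: continuous_sinv.
move=> x O /subsemigroup_nbhsP[t tO].
pose p := [seq act (sinv x) (act x n) | n <- t].
exists [set b | agree_on p (act b) (act x)],
  [set w | agree_on (t ++ p) (act w) (act (x * sinv x)%g)].
split; first by apply/subsemigroup_nbhsP; exists p.
  by apply/subsemigroup_nbhsP; exists (t ++ p).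
move=> s [[b [e [bx [/agree_catP[_ ep] _] bes]]] /agree_catP[st _]].
apply: tO => n nt; have pn : act (sinv x) (act x n) \in p by exact: map_f.
by apply: (act_eq_of_factor cS _ _ _ bes); [apply: bx|apply: ep|apply: st].
Qed.
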